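(* Let $P,Q\in\mathcal{B}(\mathcal{H})^{Id}$. Then: (i) $P\vee_{\preceq} Q$ exists and equals $I$ if and only if $N(P)\cap N(Q)\subseteq\overline{R(P)+R(Q)}$. (ii) $P\wedge_{\preceq} Q$ exists and equals $0$ if and only if $R(P)\cap R(Q)\subseteq\overline{N(P)+N(Q)}$.
   Context: $\mathcal{H}$ is a separable complex Hilbert space; $\mathcal{B}(\mathcal{H})^{Id}$ is the set of all bounded idempotent operators ($P^2=P$, not necessarily self-adjoint) on $\mathcal{H}$. $N(T)$ and $R(T)$ denote the null space and range of $T$; a bar denotes norm closure; $\mathcal{M}+\mathcal{N}$ is the linear span of the two subspaces. For $P,Q\in\mathcal{B}(\mathcal{H})^{Id}$ write $P\preceq Q$ if $PQ=QP=P$; this is a partial order on $\mathcal{B}(\mathcal{H})^{Id}$. $P\vee_{\preceq}Q$ (respectively $P\wedge_{\preceq}Q$) denotes the least upper bound (respectively greatest lower bound) of $P$ and $Q$ in the partially ordered set $(\mathcal{B}(\mathcal{H})^{Id},\preceq)$, if it exists. *)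

(* Defs.v *)
From HB Require Import structures.
From mathcomp Require Import all_boot all_order all_algebra.
From mathcomp Require Import all_classical all_reals all_analysis.
From mathcomp.real_closed Require Import complex.

Set Implicit Arguments.
Unset Strict Implicit.
Unset Printing Implicit Defensive.

Import Order.TTheory GRing.Theory Num.Theory.
Import numFieldNormedType.Exports.

Local Open Scope classical_set_scope.
Local Open Scope ring_scope.

Definition separable_space (T : topologicalType) : Prop :=
  exists2 D : set T, countable D & dense D.

(* The norm of a [normedModType K] is [K]-valued, hence so is the bound [M]; it
   is necessarily real unless [V] is the zero space. *)
Definition bounded_op (K : numFieldType) (V W : normedModType K) (f : V -> W) : Prop :=
  exists M : K, forall x, `|f x| <= M * `|x|.

Record bidem (K : numFieldType) (V : normedModType K) : Type := Bidem {
  bidem_fun :> V -> V;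
  bidem_linear : linear bidem_fun;
  bidem_bounded : bounded_op bidem_fun;
  bidem_idem : bidem_fun \o bidem_fun = bidem_fun }.

HB.instance Definition _ (K : numFieldType) (V : normedModType K)
    (P : bidem V) :=
  GRing.isLinear.Build K V V _ (bidem_fun P) (bidem_linear P).

HB.instance Definition _ (K : numFieldType) (V : normedModType K) :=
  gen_eqMixin (bidem V).
HB.instance Definition _ (K : numFieldType) (V : normedModType K) :=
  gen_choiceMixin (bidem V).

Section BidemOrder.
Context {K : numFieldType} {V : normedModType K}.
Implicit Types P Q S : bidem V.

Lemma bidem_ext P Q : bidem_fun P = bidem_fun Q -> P = Q.
Proof.
case: P Q => [p lp bp ip] [q lq bq iq] /= pq; move: lp bp ip lq bq iq.
rewrite pq => lp bp ip lq bq iq.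
by congr Bidem; exact: Prop_irrelevance.
Qed.

Definition bidem_le P Q : bool := `[< P \o Q = P /\ Q \o P = P >].

Lemma bidem_lexx : reflexive bidem_le.
Proof. by move=> P; apply/asboolP; rewrite bidem_idem. Qed.

Lemma bidem_le_anti : antisymmetric bidem_le.
Proof.
by move=> P Q /andP[/asboolP[PQ _] /asboolP[_ QP]]; apply: bidem_ext; rewrite -PQ.
Qed.

Lemma bidem_le_trans : transitive bidem_le.
Proof.
move=> Q P S /asboolP[PQ QP] /asboolP[QS SQ]; apply/asboolP; split.
- by rewrite -PQ -compA QS.
- by rewrite -QP compA SQ.
Qed.

Fact bidem_display : Order.disp_t. Proof. exact: Order.Disp tt tt. Qed.

HB.instance Definition _ := Order.Le_isPOrder.Build bidem_display (bidem V)
  bidem_lexx bidem_le_anti bidem_le_trans.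

Lemma bidem_leP P Q : reflect (P \o Q = P /\ Q \o P = P) (P <= Q)%O.
Proof. exact: asboolP. Qed.

End BidemOrder.

Section BidemConst.
Context {K : numFieldType} (V : normedModType K).

Definition bidem1 : bidem V.
Proof.
exists idfun; [by [] | by exists 1 => x; rewrite mul1r | by []].
Defined.

Definition bidem0 : bidem V.
Proof.
exists (fun=> 0); [by move=> a x y; rewrite scaler0 addr0 | | by []].
by exists 0 => x; rewrite normr0 mul0r.
Defined.

End BidemConst.

Definition nullspace (K : numFieldType) (V W : normedModType K) (f : V -> W) : set V :=
  [set x | f x = 0].

(* For linear subspaces this is the linear span of the union. *)
Definition sumset (V : zmodType) (M N : set V) : set V :=
  [set x + y | x in M & y in N].

(* Main.v *)
(* With E = I - S, an idempotent S is an upper bound of P and Q iff R(E) is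
   contained in N(P) and N(Q), and N(E) contains R(P) + R(Q); dually, E is a
   lower bound iff R(E) is contained in R(P) and R(Q), and N(E) contains
   N(P) + N(Q).  So both parts ask when, given subspaces M and N, E = 0 is the
   only idempotent whose range lies in N and whose kernel contains M.  If N lies
   in the closure of M, then E = E E = 0 because N(E) is closed.  Otherwise take
   x in N outside the closure of M, let l be the projection of x on that closure
   and f = <., x - l>; then E y = (f y / f x) x is a nonzero such idempotent. *)

Require Import Defs.
From HB Require Import structures.
From mathcomp Require Import all_boot all_order all_algebra.
From mathcomp Require Import all_classical all_reals all_analysis.
From mathcomp Require Import ring lra.
From mathcomp.real_closed Require Import complex.

Import Order.TTheory GRing.Theory Num.Theory.
Import numFieldNormedType.Exports.

Local Open Scope classical_set_scope.
Local Open Scope ring_scope.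

(** * Orthogonal decomposition along a vector and its consequences *)

Section DotProduct.
Context {C : numClosedFieldType} {U : lmodType C} (ip : {dot U for @Num.conj C}).

(** Pythagoras: [u] is its component along [v] plus a remainder orthogonal to [v]. *)
Lemma dnorm_project (u v : U) : v != 0 ->
  ip u u = ip (u - (ip u v / ip v v) *: v) (u - (ip u v / ip v v) *: v)
           + `|ip u v| ^+ 2 / ip v v.
Proof.
move=> v0; have vv0 : ip v v != 0 by rewrite dnorm_eq0.
set a := ip u v / ip v v.
have o : ip (u - a *: v) (a *: v) = 0.
  by rewrite linearZr_LR /= linearBl linearZl_LR /= divfK // subrr mulr0.
rewrite -{1 2}(subrK (a *: v) u) (hnormDd o) /=; congr (_ + _).
rewrite dnormZ normrM normfV (ger0_norm (dnorm_ge0 ip v)); by field.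
Qed.

Lemma dot_CauchySchwarz (u v : U) : `|ip u v| ^+ 2 <= ip u u * ip v v.
Proof.
have [->|v0] := eqVneq v 0; first by rewrite !linear0r normr0 expr0n.
rewrite -ler_pdivrMr ?dnorm_gt0// (dnorm_project u v v0) lerDr.
exact: dnorm_ge0.
Qed.

(** Subtracting from [u] its component along [v] lowers [ip u u] by [|ip u v| ^ 2 / ip v v].
    Minimality forbids a positive drop, so [ip u v] vanishes. *)
Lemma dot_eq0_of_minimal (u v : U) :
  (forall a, ip u u <= ip (u - a *: v) (u - a *: v)) -> ip u v = 0.
Proof.
have [->|v0] := eqVneq v 0; first by rewrite linear0r.
move=> /(_ (ip u v / ip v v)); rewrite {1}(dnorm_project u v v0) gerDl.
rewrite pmulr_lle0 ?invr_gt0 ?dnorm_gt0// => h.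
apply/eqP; rewrite -normr_eq0 -sqrf_eq0; apply/eqP/le_anti.
by rewrite h exprn_ge0.
Qed.

End DotProduct.

Lemma bounded_op_closure_eq0 {K : numFieldType} {V W : normedModType K}
    (f : V -> W) (M : set V) :
  linear f -> bounded_op f -> M `<=` nullspace f -> closure M `<=` nullspace f.
Proof.
move=> fL [B fB] Mf x clx; apply/eqP; rewrite -normr_le0.
apply/ler_addgt0Pr => e e0; rewrite add0r.
(* [B] may be zero, and need not be real when [V] is trivial; [|B| + 1] is a positive bound in every
   case. *)
have B1 : 0 < `|B| + 1 by rewrite ltr_wpDl.
have [m [Mm]] := clx _ (nbhsx_ballx x (e / (`|B| + 1)) (divr_gt0 e0 B1)).
rewrite -ball_normE /ball_ /= ltr_pdivlMr// => xm.
have -> : f x = f (x - m).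
  by rewrite -scaleN1r addrC fL (Mf _ Mm) scaler0 add0r.
apply: (le_trans _ (ltW xm)); rewrite mulrC.
have h := fB (x - m); apply: (le_trans h).
rewrite -[leLHS]ger0_norm ?(le_trans _ h)// normrM normr_id.
by rewrite ler_wpM2r// lerDl.
Qed.

Definition linear_set {K : numFieldType} {V : normedModType K} (M : set V) :=
  M 0 /\ forall (a : K) x y, M x -> M y -> M (a *: x + y).

(** * Projection on the closure of a subspace, and rank-one idempotents *)

Section Hilbert.
Context {R : realType} {H : completeNormedModType R[i]}.
Context {ip : {dot H for @Num.conj R[i]}}.
Context (ip_norm : forall x : H, `|x| ^+ 2 = ip x x).

Lemma dot_norm_bound (u v : H) : `|ip u v| <= `|u| * `|v|.
Proof.
rewrite -(@ler_pXn2r _ 2)// ?nnegrE ?mulr_ge0//.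
by rewrite exprMn !ip_norm; exact: dot_CauchySchwarz.
Qed.

Lemma parallelogram (u v : H) :
  `|u + v| ^+ 2 + `|u - v| ^+ 2 = 2 * `|u| ^+ 2 + 2 * `|v| ^+ 2.
Proof. rewrite !ip_norm dnormD dnormB; ring. Qed.

(** The near-minimizers of the distance from [x] to [M] form a Cauchy filter by the parallelogram
    law. Completeness gives a limit [l] at distance at most the infimum, and minimality makes
    [x - l] orthogonal to [M]. *)
Lemma exists_projection (M : set H) (x : H) :
  linear_set M -> exists2 l, closure M l & forall m, M m -> ip (x - l) m = 0.
Proof.
move=> [M0 ML].
(* The norm takes values in [R[i]]; its real part brings it to [R], where infima exist and the order
   is total. *)
pose nr (y : H) : R := complex.Re `|y|.
have nrE y : real_complex R (nr y) = `|y| by rewrite RRe_real// normr_real.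
have nr_ge0 y : 0 <= nr y by rewrite -ler0c nrE.
have nrD y z : nr (y + z) <= nr y + nr z.
  by rewrite -lecR rmorphD /= !nrE ler_normD.
have nrN y : nr (- y) = nr y by rewrite /nr normrN.
have par y z : nr (y + z) ^+ 2 + nr (y - z) ^+ 2 = 2 * nr y ^+ 2 + 2 * nr z ^+ 2.
  apply: (@complexI R); rewrite !(rmorphD, rmorphM, rmorphXn, rmorph_nat) /=.
  by rewrite !nrE parallelogram.
pose A := [set nr (x - m) | m in M]; pose d := inf A.
have infA : has_inf A.
  by split; [exists (nr (x - 0)), 0|exists 0 => _ [m _ <-]].
have dA m : M m -> d <= nr (x - m).
  by move=> Mm; apply: ge_inf; [exact: infA.2|exists m].
have d0 : 0 <= d by apply: lb_le_inf; [exact: infA.1|move=> _ [m _ <-]].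
pose B e := [set m | M m /\ nr (x - m) < d + e].
pose F := filter_from [set e | 0 < e] B.
have Bmin e e' : B (Num.min e e') `<=` B e `&` B e'.
  move=> m [Mm]; rewrite -ltrBlDl lt_min !ltrBlDl => /andP[h h'].
  by split; split.
have B_neq0 e : 0 < e -> B e !=set0.
  by move=> e0; have [_ [m Mm <-] h] := inf_adherent e0 infA; exists m.
have FF : ProperFilter F.
  apply: filter_from_proper; last exact: B_neq0.
  apply: filter_from_filter; first by exists 1; exact: ltr01.
  move=> e e' /= e0 e'0; exists (Num.min e e'); last exact: Bmin.
  by rewrite /= lt_min e0.
have FC e : 0 < e -> exists2 t, 0 < t &
    forall m m', B t m -> B t m' -> nr (m - m') < e.
  move=> e0; have D0 : 0 < 8 * d + 5 by lra.
  (* [8 d t + 4 t ^ 2 <= t (8 d + 4)] bounds the parallelogram defect. *)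
  pose t := Num.min 1 (e ^+ 2 / (8 * d + 5)).
  have t0 : 0 < t by rewrite lt_min ltr01 divr_gt0 ?exprn_gt0.
  have t1 : t <= 1 by rewrite ge_min lexx.
  have te : t * (8 * d + 5) <= e ^+ 2.
    by rewrite -ler_pdivlMr// ge_min lexx orbT.
  exists t => // m m' [Mm hm] [Mm' hm'].
  rewrite -(@ltr_pXn2r _ 2)// ?nnegrE ?(ltW e0)//.
  (* The midpoint of [m] and [m'] lies in [M], so its distance to [x] is at least [d]. The
     parallelogram law then bounds the square of [nr (m - m')] by [4 (d + t) ^ 2 - 4 d ^ 2]. *)
  have mid : 2 * d <= nr ((x - m') + (x - m)).
    have -> : (x - m') + (x - m) = (2 : R[i]) *: (x - (2^-1 : R[i]) *: (m + m')).
      rewrite scalerBr scalerA divff ?pnatr_eq0// scale1r scaler_nat mulr2n.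
      by rewrite opprD addrACA [- m' - m]addrC.
    have -> y : nr ((2 : R[i]) *: y) = 2 * nr y.
      apply: (@complexI R); rewrite rmorphM rmorph_nat /= !nrE normrZ.
      by rewrite ger0_norm.
    rewrite ler_pM2l//; apply: dA; rewrite -[_ *: _]addr0; apply: (ML) => //.
    by rewrite -[m]scale1r; exact: ML.
  have := par (x - m') (x - m).
  have -> : x - m' - (x - m) = m - m' by rewrite opprB addrC subrKA.
  have := nr_ge0 (x - m); have := nr_ge0 (x - m').
  by nra.
have /cvg_ex[l Fl] : cvg F.
  apply: cauchy_cvg; apply: cauchy_exP => e e0.
  have eR : real_complex R (complex.Re e) = e by rewrite RRe_real// gtr0_real.
  have [t t0 ht] := FC (complex.Re e) ltac:(by rewrite -ltcR eR).
  have [m Bm] := B_neq0 _ t0.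
  exists m, t => // m' Bm'; rewrite -ball_normE /ball_ /= -eR -nrE ltcR.
  exact: ht.
(* Convergence of [F] puts some [B t] inside the ball about [l]; a point of [B (min e t)] is then
   both a near-minimizer and close to [l]. *)
have near_l e : 0 < e -> exists2 m, B e m & nr (l - m) < e.
  move=> e0.
  have /Fl[t t0 ht] : nbhs l (ball l (real_complex R e)).
    by apply: nbhsx_ballx; rewrite ltcR.
  have [m /Bmin[Be Bt]] := B_neq0 (Num.min e t) ltac:(by rewrite lt_min e0).
  exists m => //; have := ht _ Bt.
  by rewrite -ball_normE /ball_ /= -nrE ltcR.
have xl : nr (x - l) <= d.
  apply/ler_addgt0Pr => e e0.
  have [m [_ xm] lm] := near_l (e / 2) (divr_gt0 e0 (ltr0Sn _ _)).
  have := nrD (x - m) (m - l); rewrite subrKA -(nrN (m - l)) opprB; lra.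
exists l.
  move=> S /nbhs_ballP[e /= e0 le].
  have eR : real_complex R (complex.Re e) = e by rewrite RRe_real// gtr0_real.
  have [m [Mm _] lm] := near_l (complex.Re e) ltac:(by rewrite -ltcR eR).
  exists m; split => //; apply: le.
  by rewrite -ball_normE /ball_ /= -eR -nrE ltcR.
(* Since [l] is only in the closure of [M], the competitor [l + a *: m] is approximated by
   [a *: m + m'] with [m'] in [M] near [l], to which the bound [d] applies. *)
move=> m Mm; apply: dot_eq0_of_minimal => a; rewrite -!ip_norm -!nrE.
rewrite -!rmorphXn lecR ler_pXn2r ?nnegrE// (le_trans xl)//.
apply/ler_addgt0Pr => e e0; have [m' [Mm' _] lm'] := near_l e e0.
have := dA _ (ML a _ _ Mm Mm').
have := nrD (x - l - a *: m) (l - m').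
have -> : x - l - a *: m + (l - m') = x - (a *: m + m').
  by rewrite [LHS]addrAC subrKA opprD addrA [LHS]addrAC.
lra.
Qed.

Lemma exists_rank1_idempotent (M : set H) (x : H) :
  linear_set M -> ~ closure M x ->
  exists E : bidem H, [/\ E x = x, forall y, exists c : R[i], E y = c *: x &
    M `<=` nullspace E].
Proof.
move=> linM clx; have [l cll lM] := exists_projection M x linM.
have M0 : M 0 := linM.1.
pose w := x - l; pose f y : R[i] := ip y w.
have fP a y z : f (a *: y + z) = a * f y + f z.
  by rewrite /f linearDl linearZl_LR.
have fZ a y : f (a *: y) = a * f y by rewrite /f linearZl_LR.
have Mf m : M m -> f m = 0.
  by move=> Mm; apply/eqP; rewrite /f herm_eq0C; apply/eqP/lM.
have x0 : x != 0.
  by apply: contra_not_neq clx => ->; exact: subset_closure.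
have fxL : linear (fun y => f y *: x).
  by move=> a y z; rewrite fP scalerDl scalerA.
have fxB : bounded_op (fun y => f y *: x).
  exists (`|w| * `|x|) => y; rewrite normrZ mulrAC ler_wpM2r// mulrC.
  exact: dot_norm_bound.
(* The functional [f] vanishes on [M], hence at [l] by continuity. The argument passes through the
   operator [f y *: x], already known to be bounded, and cancels [x]. *)
have fl : f l = 0.
  have fxM : M `<=` nullspace (fun y => f y *: x).
    by move=> m Mm; rewrite /nullspace /= Mf// scale0r.
  have /eqP := bounded_op_closure_eq0 _ M fxL fxB fxM l cll.
  by rewrite scaler_eq0 (negPf x0) orbF => /eqP.
(* As [f l = 0], the value [f x] is [ip w w], which is nonzero because [x] differs from [l]. *)
have fx : f x != 0.
  have -> : f x = f w.
    by rewrite -[x](subrK l) -[x - l]scale1r fP fl mul1r addr0.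
  rewrite /f dnorm_eq0 subr_eq0; apply: contra_not_neq clx => ->.
  exact: cll.
pose E y := (f x)^-1 *: (f y *: x).
have EL : linear E.
  by move=> a y z; rewrite /E fxL scalerDr !scalerA (mulrC a).
have EB : bounded_op E.
  have [B fB] := fxB; exists (`|(f x)^-1| * B) => y.
  by rewrite normrZ -mulrA ler_wpM2l.
have Ex : E x = x by rewrite /E scalerA mulVf// scale1r.
have EE : E \o E = E.
  by apply/funext => y; rewrite /E /= !fZ mulrCA mulVf// mulr1.
exists (Bidem EL EB EE); split => //= [y|m Mm].
  by exists ((f x)^-1 * f y); rewrite -scalerA.
by rewrite /nullspace /= /E (Mf m Mm) scale0r scaler0.
Qed.

End Hilbert.

(** * The order on idempotents in terms of ranges and null spaces *)

Section Order.
Context {K : numFieldType} {V : normedModType K}.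
Implicit Types (P Q S E : bidem V) (M N : set V).

Lemma bidemK P x : P (P x) = P x.
Proof. exact: (congr1 (@^~ x) (bidem_idem P)). Qed.

Definition bidemC P : bidem V.
Proof.
exists (fun x => x - P x).
- by move=> a x y; rewrite linearP scalerBr opprD addrACA.
- have [B PB] := bidem_bounded P; exists (1 + B) => x.
  by rewrite (le_trans (ler_normB _ _))// mulrDl mul1r lerD2l.
- by apply/funext => x /=; rewrite linearB /= bidemK subrr subr0.
Defined.

Lemma bidem_le_pointwise P Q :
  (P <= Q)%O <-> (forall x, P (Q x) = P x) /\ (forall x, Q (P x) = P x).
Proof.
split=> [/bidem_leP[PQ QP]|[PQ QP]].
  by split=> x; [exact: (congr1 (@^~ x) PQ)|exact: (congr1 (@^~ x) QP)].
by apply/bidem_leP; split; apply/funext.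
Qed.

Lemma bidemCK : involutive bidemC.
Proof. by move=> P; apply: bidem_ext; apply/funext => x /=; rewrite subKr. Qed.

Lemma bidem_le1 P : (P <= bidem1 V)%O.
Proof. exact/bidem_le_pointwise. Qed.

Lemma bidem_ge0 P : (bidem0 V <= P)%O.
Proof. by apply/bidem_le_pointwise; split=> x //=; rewrite linear0. Qed.

Lemma bidemC1_eq0 P : bidemC P = bidem0 V -> P = bidem1 V.
Proof.
move=> /(congr1 (fun E : bidem V => E : V -> V)) P1.
apply: bidem_ext; apply/funext => x /=.
by apply/esym/eqP; rewrite -subr_eq0; apply/eqP/(congr1 (@^~ x) P1).
Qed.

Lemma bidemC1 : bidemC (bidem1 V) = bidem0 V.
Proof. by apply: bidem_ext; apply/funext => x /=; rewrite subrr. Qed.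

(** [P] fixes exactly the vectors of its range, so the first inclusion amounts to [P E = E]. The
    vectors [x - P x] fill the null space of [P], so the second amounts to [E P = E]. *)
Lemma bidem_le_range_null E P :
  (E <= P)%O <-> range E `<=` range P /\ nullspace P `<=` nullspace E.
Proof.
rewrite bidem_le_pointwise; split=> [[EP PE]|[rE nP]]; split.
- by move=> _ [x _ <-]; exists (E x).
- by move=> x Px; rewrite /nullspace /= -EP Px linear0.
- move=> x; apply/eqP; rewrite -subr_eq0 -linearB; apply/eqP/nP.
  by rewrite /nullspace /= linearB /= bidemK subrr.
- by move=> x; have [z _ <-] := rE _ (imageT E x); rewrite bidemK.
Qed.

(** Expanding the products with [I - E] turns the order relation into [P E = E P = 0]. *)
Lemma bidem_le_complement E P :
  (P <= bidemC E)%O <-> range E `<=` nullspace P /\ range P `<=` nullspace E.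
Proof.
rewrite bidem_le_pointwise; split=> [[PE EP]|[rE rP]]; split.
- move=> _ [x _ <-]; have /eqP := PE x; rewrite /= linearB /=.
  by rewrite -subr_eq0 addrAC subrr add0r oppr_eq0 => /eqP.
- move=> _ [x _ <-]; have /eqP := EP x; rewrite /=.
  by rewrite -subr_eq0 addrAC subrr add0r oppr_eq0 => /eqP.
- by move=> x /=; rewrite linearB /= (rE _ (imageT E x)) subr0.
- by move=> x /=; rewrite (rP _ (imageT P x)) subr0.
Qed.

Lemma sumset_subset_nullspace (A B : set V) E : A 0 -> B 0 ->
  sumset A B `<=` nullspace E <-> A `<=` nullspace E /\ B `<=` nullspace E.
Proof.
move=> A0 B0; split=> [AB|[AE BE] _ [x Ax [y By <-]]].
  split=> x Xx; apply: AB; first by exists x => //; exists 0; rewrite ?addr0.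
  by exists 0 => //; exists x; rewrite ?add0r.
by rewrite /nullspace /= linearD /= (AE x Ax) (BE y By) addr0.
Qed.

Lemma range_bidem0 P : range P 0.
Proof. by exists 0; rewrite ?linear0. Qed.

Lemma nullspace_bidem0 P : nullspace P 0.
Proof. exact: linear0. Qed.

(** The identity is always an upper bound, so it is the least one exactly when every upper bound is
    the identity. Upper bounds correspond to the idempotents [E] below through [E = I - S]. *)
Lemma supremums_bidem1P P Q :
  supremums [set P; Q] (bidem1 V) <->
  forall E, range E `<=` nullspace P `&` nullspace Q ->
    sumset (range P) (range Q) `<=` nullspace E -> E = bidem0 V.
Proof.
split=> [[_ lb] E|h]; last split.
- rewrite subsetI sumset_subset_nullspace; try exact: range_bidem0.
  move=> [EP EQ] [PE QE].
  have : (bidem1 V <= bidemC E)%O.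
    by apply: lb => _ [|] ->; apply/bidem_le_complement.
  move=> leE; have CE1 : bidemC E = bidem1 V.
    by apply/le_anti; rewrite leE bidem_le1.
  by rewrite -[E]bidemCK CE1 bidemC1.
- by move=> S _; exact: bidem_le1.
- move=> S ubS; rewrite (bidemC1_eq0 S) ?lexx//.
  (* Writing [S] as a double complement lets the criterion speak of [bidemC S]. *)
  have /bidem_le_complement[PE EP] : (P <= bidemC (bidemC S))%O.
    by rewrite bidemCK; apply: ubS; left.
  have /bidem_le_complement[QE EQ] : (Q <= bidemC (bidemC S))%O.
    by rewrite bidemCK; apply: ubS; right.
  apply: h; first by rewrite subsetI.
  by apply/sumset_subset_nullspace; [exact: range_bidem0..|].
Qed.

(** Zero is always a lower bound, and here [E] is itself the lower bound, with no passage to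
    complements. *)
Lemma infimums_bidem0P P Q :
  infimums [set P; Q] (bidem0 V) <->
  forall E, range E `<=` range P `&` range Q ->
    sumset (nullspace P) (nullspace Q) `<=` nullspace E -> E = bidem0 V.
Proof.
split=> [[_ ub] E|h]; last split.
- rewrite subsetI sumset_subset_nullspace; try exact: nullspace_bidem0.
  move=> [EP EQ] [PE QE].
  apply/le_anti; rewrite bidem_ge0 andbT; apply: ub.
  by move=> _ [|] ->; apply/bidem_le_range_null.
- by move=> S _; exact: bidem_ge0.
- move=> S lbS; rewrite (h S) ?lexx//.
    rewrite subsetI; split.
      by have /bidem_le_range_null[] := lbS P (or_introl erefl).
    by have /bidem_le_range_null[] := lbS Q (or_intror erefl).
  apply/sumset_subset_nullspace; try exact: nullspace_bidem0.
  split.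
    by have /bidem_le_range_null[] := lbS P (or_introl erefl).
  by have /bidem_le_range_null[] := lbS Q (or_intror erefl).
Qed.

Lemma linear_range P : linear_set (range P).
Proof.
split=> [|a _ _ [x _ <-] [y _ <-]]; first exact: range_bidem0.
by exists (a *: x + y); rewrite ?linearP.
Qed.

Lemma linear_nullspace P : linear_set (nullspace P).
Proof.
split=> [|a x y Px Py]; first exact: nullspace_bidem0.
by rewrite /nullspace /= linearP /= Px Py scaler0 addr0.
Qed.

Lemma linear_sumset M N :
  linear_set M -> linear_set N -> linear_set (sumset M N).
Proof.
move=> [M0 ML] [N0 NL]; split; first by exists 0 => //; exists 0; rewrite ?addr0.
move=> a _ _ [x Mx [y Ny <-]] [x' Mx' [y' Ny' <-]].
exists (a *: x + x'); first exact: ML.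
exists (a *: y + y'); first exact: NL.
by rewrite scalerDr addrACA.
Qed.

Lemma linear_setI M N :
  linear_set M -> linear_set N -> linear_set (M `&` N).
Proof.
move=> [M0 ML] [N0 NL]; split=> // a x y [Mx Nx] [My Ny].
by split; [exact: ML|exact: NL].
Qed.

End Order.

(** * Inclusion in a closure tested by idempotents, and the theorem *)

Lemma subset_closureP {R : realType} {H : completeNormedModType R[i]}
    {ip : {dot H for @Num.conj R[i]}} (ip_norm : forall x : H, `|x| ^+ 2 = ip x x)
    (M N : set H) :
  linear_set M -> linear_set N ->
  N `<=` closure M <->
  forall E : bidem H, range E `<=` N -> M `<=` nullspace E -> E = bidem0 H.
Proof.
move=> linM [N0 NL]; split=> [NM E EN ME|h x Nx].
  apply: bidem_ext; apply/funext => x /=.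
  rewrite -bidemK.
  apply: (bounded_op_closure_eq0 _ M (bidem_linear E) (bidem_bounded E) ME).
  exact/NM/EN/imageT.
apply: contrapT => clx.
have [E [Ex EN ME]] := exists_rank1_idempotent ip_norm M x linM clx.
have E0 : E = bidem0 H.
  apply: h ME => _ [y _ <-]; have [c ->] := EN y.
  by rewrite -[_ *: _]addr0; exact: NL.
(* From [E x = x] and [E = 0] follows [x = 0], which belongs to [M]. *)
apply: clx; rewrite -Ex E0; exact: (subset_closure linM.1).
Qed.

Theorem theorem2p5 (R : realType) (H : completeNormedModType R[i])
    (ip : {dot H for @Num.conj R[i]})
    (ip_norm : forall x : H, `|x| ^+ 2 = ip x x)
    (sepH : separable_space H)
    (P Q : bidem H) :
  (supremums [set P; Q] (bidem1 H) <->
     nullspace P `&` nullspace Q `<=` closure (sumset (range P) (range Q)))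
  /\
  (infimums [set P; Q] (bidem0 H) <->
     range P `&` range Q `<=` closure (sumset (nullspace P) (nullspace Q))).
Proof.
split.
  rewrite supremums_bidem1P (subset_closureP ip_norm) //.
    by apply: linear_sumset; exact: linear_range.
  by apply: linear_setI; exact: linear_nullspace.
rewrite infimums_bidem0P (subset_closureP ip_norm) //.
  by apply: linear_sumset; exact: linear_nullspace.
by apply: linear_setI; exact: linear_range.
Qed.
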